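(* Let $f:\mathbb{R}\to\mathbb{R}$ be $\mathcal{C}^1$ and convex, and let $u_l>u_r$. Consider the Cauchy problem $\partial_t u+\partial_x f(u)=0$ with the pure shock initial datum $$u_{|t=0}(x)=u_l\mathbf{1}_{x<0}+u_r\mathbf{1}_{x>0},$$ whose exact (entropy) solution is $$u_{\mathrm{exa}}(t,x)=u_l\mathbf{1}_{x<\sigma t}+u_r\mathbf{1}_{x>\sigma t},\qquad \sigma=\frac{f(u_l)-f(u_r)}{u_l-u_r}.$$ Then the reconstruction scheme (defined in the context) is exact: for every $n\ge0$ and $j\in\mathbb{Z}$, $$u_j^n=\frac1{\Delta x}\int_{x_{j-1/2}^n}^{x_{j+1/2}^n}u_{\mathrm{exa}}(t^n,x)\,dx .$$
   Context: Reconstruction scheme for the scalar law $\partial_t u+\partial_x f(u)=0$, with $f$ convex and $\mathcal{C}^1$. Fix $\Delta x>0$; $t^0=0$, $t^{n+1}=t^n+\Delta t^n$ with $\Delta t^n>0$. Initially $x_{j+1/2}^0=j\Delta x+\frac{\Delta x}{2}$ and $u_j^0=\frac1{\Delta x}\int_{x_{j-1/2}^0}^{x_{j+1/2}^0}u_{|t=0}(x)\,dx$ for $j\in\mathbb{Z}$. During $[t^n,t^{n+1}]$ the mesh moves with a speed $V_{\mathrm{mesh}}^n\ne0$ satisfying $|V_{\mathrm{mesh}}^n|\ge V_{\mathrm{waves}}^n:=\max_j|f'(u_j^n)|$, i.e. $x_{j+1/2}^{n+1}=x_{j+1/2}^n+V_{\mathrm{mesh}}^n\Delta t^n$. The CFL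 condition $\Delta t^n\le\frac{\Delta x}{|V_{\mathrm{mesh}}^n|+V_{\mathrm{waves}}^n}$ is imposed. Write $\Delta t=\Delta t^n$. Step 1 (reconstruction). Let $$d_j^n=\Delta x\,\frac{u_{j+1}^n-u_j^n}{u_{j+1}^n-u_{j-1}^n}.$$ If $u_{j-1}^n>u_{j+1}^n$ and $0<d_j^n<\Delta x$, a reconstruction is performed in cell $j$: $u_{j,L}^n=u_{j-1}^n$, $u_{j,R}^n=u_{j+1}^n$, $\sigma_j^n=\frac{f(u_{j,L}^n)-f(u_{j,R}^n)}{u_{j,L}^n-u_{j,R}^n}$. Otherwise no reconstruction is performed: $u_{j,L}^n=u_{j,R}^n=u_j^n$ and $\sigma_j^n=f'(u_j^n)$. Step 2 (fluxes). If $V_{\mathrm{mesh}}^n<0$, then for every $j$, with $\tau=\min\left(\Delta t,\frac{\Delta x-d_j^n}{\sigma_j^n-V_{\mathrm{mesh}}^n}\right)$, $$\Delta t\, f_{j+1/2}^n=\tau\left(f(u_{j,R}^n)-V_{\mathrm{mesh}}^n u_{j,R}^n\right)+(\Delta t-\tau)\left(f(u_{j,L}^n)-V_{\mathrm{mesh}}^n u_{j,L}^n\right).$$ If $V_{\mathrm{mesh}}^n>0$, then for every $j$, with $\tau=\min\left(\Delta t,\frac{d_j^n}{V_{\mathrm{mesh}}^n-\sigma_j^n}\right)$, $$\Delta t\, f_{j-1/2}^n=\tau\left(f(u_{j,L}^n)-V_{\mathrm{mesh}}^n u_{j,L}^n\right)+(\Delta t-\tau)\left(f(u_{j,R}^n)-V_{\mathrm{mesh}}^n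 u_{j,R}^n\right).$$ When a reconstruction is performed and the denominator in $\tau$ vanishes, the corresponding crossing time is taken to be $+\infty$. When no reconstruction is performed in cell $j$, one has $u_{j,L}^n=u_{j,R}^n$, so the values of $d_j^n$ and $\tau$ are irrelevant (they may be set arbitrarily if undefined). Step 3 (update). $u_j^{n+1}=u_j^n-\frac{\Delta t^n}{\Delta x}\left(f_{j+1/2}^n-f_{j-1/2}^n\right)$. *)

(* Defs.v *)
From HB Require Import structures.
From mathcomp Require Import all_boot all_order all_algebra.
From mathcomp Require Import all_classical all_reals all_analysis.
Set Implicit Arguments.
Unset Strict Implicit.
Unset Printing Implicit Defensive.
Import Order.TTheory GRing.Theory Num.Theory.
Import numFieldNormedType.Exports.
Local Open Scope classical_set_scope.
Local Open Scope ring_scope.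

Definition cell_average (R : realType) (dx a b : R) (v : R -> R) : R :=
  dx^-1 * \int[lebesgue_measure]_(x in `[a, b]) v x.

Section Scheme.
Variables (R : realType) (f : R -> R) (dx : R) (dt Vmesh : nat -> R).

Fixpoint time (n : nat) : R :=
  if n is m.+1 then time m + dt m else 0.

(* [interface n j] is x_{j+1/2}^n, hence x_{j-1/2}^n is [interface n (j - 1)]. *)
Fixpoint interface (n : nat) (j : int) : R :=
  if n is m.+1 then interface m j + Vmesh m * dt m else j%:~R * dx + dx / 2.

(* The supremum is the maximum whenever the latter exists, see [Vwaves_max]. *)
Definition Vwaves (u : int -> R) : R :=
  sup (range (fun j => `|(f^`()%classic) (u j)|)).

Lemma Vwaves_max (u : int -> R) (i : int) :
  (forall j, `|(f^`()%classic) (u j)| <= `|(f^`()%classic) (u i)|) -> Vwaves u = `|(f^`()%classic) (u i)|.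
Proof.
move=> ui; have ub : ubound (range (fun j => `|(f^`()%classic) (u j)|)) `|(f^`()%classic) (u i)|.
  by move=> _ [j _ <-]; exact: ui.
apply/eqP; rewrite eq_le; apply/andP; split.
  by apply: ge_sup => //; exists `|(f^`()%classic) (u i)|; exists i.
by apply: ub_le_sup; [exists `|(f^`()%classic) (u i)| | exists i].
Qed.

Section Step.
Variables (u : int -> R) (delta V : R).

Definition shock_pos (j : int) : R :=
  dx * ((u (j + 1) - u j) / (u (j + 1) - u (j - 1))).

Definition reconstructed (j : int) : bool :=
  [&& u (j + 1) < u (j - 1), 0 < shock_pos j & shock_pos j < dx].

Definition uL (j : int) : R := if reconstructed j then u (j - 1) else u j.

Definition uR (j : int) : R := if reconstructed j then u (j + 1) else u j.

Definition speed (j : int) : R :=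
  if reconstructed j then (f (uL j) - f (uR j)) / (uL j - uR j)
  else (f^`()%classic) (u j).

(* min(delta, dist / rel_speed), with dist / 0 read as +oo. *)
Definition crossing_time (dist rel_speed : R) : R :=
  if rel_speed == 0 then delta else Num.min delta (dist / rel_speed).

Definition mesh_flux (v : R) : R := f v - V * v.

(* The flux through the right interface x_{j+1/2} of cell j (mesh moving left),
   resp. through the left interface x_{j-1/2} of cell j (mesh moving right). *)
Definition right_flux (j : int) : R :=
  let tau := crossing_time (dx - shock_pos j) (speed j - V) in
  (tau * mesh_flux (uR j) + (delta - tau) * mesh_flux (uL j)) / delta.

Definition left_flux (j : int) : R :=
  let tau := crossing_time (shock_pos j) (V - speed j) in
  (tau * mesh_flux (uL j) + (delta - tau) * mesh_flux (uR j)) / delta.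

(* [flux j] is f_{j+1/2}. The scheme requires V != 0, so the second branch is
   the case 0 < V; x_{j+1/2} is then the left interface of cell j + 1. *)
Definition flux (j : int) : R :=
  if V < 0 then right_flux j else left_flux (j + 1).

Definition update (j : int) : R :=
  u j - delta / dx * (flux j - flux (j - 1)).

End Step.

Fixpoint scheme (u0 : R -> R) (n : nat) : int -> R :=
  if n is m.+1 then update (scheme u0 m) (dt m) (Vmesh m)
  else fun j => cell_average dx (interface 0 (j - 1)) (interface 0 j) u0.

End Scheme.

Definition shock_datum (R : realType) (ul ur : R) (x : R) : R :=
  ul * \1_[set y | y < 0] x + ur * \1_[set y | 0 < y] x.

Definition shock_speed (R : realType) (f : R -> R) (ul ur : R) : R :=
  (f ul - f ur) / (ul - ur).

Definition shock_solution (R : realType) (f : R -> R) (ul ur t x : R) : R :=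
  let sigma := shock_speed f ul ur in
  ul * \1_[set y | y < sigma * t] x + ur * \1_[set y | sigma * t < y] x.

(* Main.v *)
Require Import Defs.
From HB Require Import structures.
From mathcomp Require Import all_boot all_order all_algebra.
From mathcomp Require Import all_classical all_reals all_analysis.
From mathcomp Require Import ring lra.
Import Order.TTheory GRing.Theory Num.Theory.
Import numFieldNormedType.Exports.
Local Open Scope classical_set_scope.
Local Open Scope ring_scope.

(** Everything depends on one number per cell, the signed distance [z] from its
    left interface to the shock, counted positive when the shock is on the
    right.  The length of the part of the cell lying behind the shock is
    [ramp z - ramp (z - dx)], where [ramp] is the positive part, so the exact
    cell average is an explicit function [profile] of [z]
    (lemma [cell_average_shock]).

    When the cell values are these averages, a reconstruction is performed
    exactly in the cell cut by the shock, that is when [0 < z < dx]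
    (lemma [reconstructed_iff_cut]).  There the neighbouring values are [ul] and
    [ur], so the reconstructed discontinuity is the true one: its position is
    [z] and its speed is the shock speed [sigma].

    Relative to the mesh the shock moves by [w = (sigma - V) * delta] during a
    step.  By the Rankine-Hugoniot relation the flux [f v - V * v] jumps by
    [(ul - ur) * (sigma - V)] across the shock, hence the flux through an
    interface at distance [y] from the shock, integrated over the step, is
    [mesh_flux ur * delta + (ul - ur) * (ramp (y + w) - ramp y)].  The numerical
    flux has this value too (lemmas [right_fluxE] and [left_fluxE]), and the
    update then telescopes to [profile (z + w)] (lemma [update_profile]).

    Those flux formulas hold when the shock does not move, relative to the mesh, in the
    direction of [V], and moves by at most one cell.  Convexity provides this:
    [sigma] lies between [f' ur] and [f' ul], and both [ul] and [ur] are attained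
    by the discrete solution, far enough on either side.  Hence [sigma] is
    bounded by the wave speed (lemma [shock_speed_le_Vwaves]), which in turn is
    bounded by the mesh speed, and the CFL condition gives [`|w| <= dx]. *)

(** * The averaged shock profile *)

Definition ramp {R : realType} (x : R) : R := Num.max x 0.

Lemma ramp_ge0 {R : realType} (x : R) : 0 <= x -> ramp x = x.
Proof. exact: max_l. Qed.

Lemma ramp_le0 {R : realType} (x : R) : x <= 0 -> ramp x = 0.
Proof. exact: max_r. Qed.

(** The average of a shock over a cell of length [dx] whose left end is at
    signed distance [z] to the left of the shock. *)
Definition profile {R : realType} (ul ur dx z : R) : R :=
  ur + (ul - ur) * ((ramp z - ramp (z - dx)) / dx).

Section Profile.
Context {R : realType} {ul ur dx : R}.
Hypothesis dx_gt0 : 0 < dx.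

Lemma profile_left (z : R) : dx <= z -> profile ul ur dx z = ul.
Proof.
have dx0 := dx_gt0 => dz.
rewrite /profile !ramp_ge0; first by field; exact: lt0r_neq0.
all: lra.
Qed.

Lemma profile_right (z : R) : z <= 0 -> profile ul ur dx z = ur.
Proof.
have dx0 := dx_gt0 => z0.
rewrite /profile !ramp_le0; first by field; exact: lt0r_neq0.
all: lra.
Qed.

Lemma profile_mid (z : R) :
  0 <= z <= dx -> profile ul ur dx z = ur + (ul - ur) * (z / dx).
Proof.
by move=> /andP[z0 zd]; rewrite /profile ramp_ge0// ramp_le0 ?subr0//; lra.
Qed.

Lemma profile_between (z : R) : ur < ul -> ur <= profile ul ur dx z <= ul.
Proof.
move=> ur_lt_ul.
have [z0|z0] := leP z 0; first by rewrite profile_right // lexx ltW.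
have [zd|zd] := leP dx z; first by rewrite profile_left // lexx ltW.
rewrite profile_mid; last by rewrite !ltW.
have t0 : 0 <= z / dx by rewrite divr_ge0 ?ltW.
have t1 : z / dx <= 1 by rewrite ler_pdivrMr // mul1r ltW.
by apply/andP; split; nra.
Qed.

End Profile.

Lemma fine_lebesgue_measure_left {R : realType} (a b s : R) : a <= b ->
  fine (lebesgue_measure ([set y | y < s] `&` `[a, b])) =
  ramp (s - a) - ramp (s - b).
Proof.
rewrite /ramp => ab; have [bs|sb] := ltP b s.
- have -> : [set y | y < s] `&` `[a, b] = `[a, b]%classic.
    apply/seteqP; split => x /=; rewrite in_itv /=; first by case.
    by move=> /andP[-> xb]; split => //; exact: le_lt_trans bs.
  rewrite lebesgue_measure_itv /= lte_fin.
  by case: (ltP a b) => ? /=; case: ltP => ?; case: ltP => ?; lra.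
- have -> : [set y | y < s] `&` `[a, b] = `[a, s[%classic.
    apply/seteqP; split => x /=; rewrite !in_itv /=.
      by case=> ? /andP[-> _].
    by move=> /andP[-> xs]; split => //=; exact: le_trans (ltW xs) sb.
  rewrite lebesgue_measure_itv /= lte_fin.
  by case: (ltP a s) => ? /=; case: ltP => ?; case: ltP => ?; lra.
Qed.

Lemma fine_lebesgue_measure_right {R : realType} (a b s : R) : a <= b ->
  fine (lebesgue_measure ([set y | s < y] `&` `[a, b])) =
  (b - a) - (ramp (s - a) - ramp (s - b)).
Proof.
rewrite /ramp => ab; have [sa|sa] := ltP s a.
- have -> : [set y | s < y] `&` `[a, b] = `[a, b]%classic.
    apply/seteqP; split => x /=; rewrite in_itv /=; first by case.
    by move=> /andP[ax ->]; split; [exact: lt_le_trans ax | rewrite ax].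
  rewrite lebesgue_measure_itv /= lte_fin.
  by case: (ltP a b) => ? /=; case: ltP => ?; case: ltP => ?; lra.
- have -> : [set y | s < y] `&` `[a, b] = `]s, b]%classic.
    apply/seteqP; split => x /=; rewrite !in_itv /=.
      by case=> -> /andP[_ ->].
    by move=> /andP[sx ->]; split => //; rewrite andbT (le_trans sa (ltW sx)).
  rewrite lebesgue_measure_itv /= lte_fin.
  by case: (ltP s b) => ? /=; case: ltP => ?; case: ltP => ?; lra.
Qed.

Lemma RintegralD_indic {R : realType} (a b al be : R) (A B : set R) :
  measurable A -> measurable B ->
  \int[lebesgue_measure]_(x in `[a, b]) (al * \1_A x + be * \1_B x) =
  al * fine (lebesgue_measure (A `&` `[a, b])) +
  be * fine (lebesgue_measure (B `&` `[a, b])).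
Proof.
move=> mA mB; set mu := lebesgue_measure.
have int C : measurable C -> mu.-integrable `[a, b] (EFin \o (\1_C : R -> R)).
  move=> mC; apply: measurable_bounded_integrable => //.
  - rewrite /= lebesgue_measure_itv.
    by case: ifP => _; rewrite ?ltry// -EFinB ltry.
  - exists 1; split => // M M1 x _ /=.
    by rewrite ger0_norm // indicE; apply: le_trans (ltW M1); case: (_ \in _).
have ind C : measurable C ->
    \int[mu]_(x in `[a, b]) \1_C x = fine (mu (C `&` `[a, b])).
  by move=> mC; rewrite /Rintegral integral_indic.
rewrite RintegralD //; last 2 first.
- exact: (integrableZl _ al (int A mA)).
- exact: (integrableZl _ be (int B mB)).
by rewrite !RintegralZl ?ind //; exact: int.
Qed.

Lemma cell_average_shock {R : realType} (f : R -> R) (ul ur dx a b t : R) :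
  0 < dx -> b = a + dx ->
  cell_average dx a b (shock_solution f ul ur t) =
  profile ul ur dx (shock_speed f ul ur * t - a).
Proof.
move=> dx_gt0 ->; rewrite /cell_average /shock_solution /profile.
set s := shock_speed f ul ur * t.
have ab : a <= a + dx by rewrite lerDl ltW.
have mlt : measurable [set y : R | y < s].
  by rewrite (_ : [set _ | _] = `]-oo, s[%classic).
have mgt : measurable [set y : R | s < y].
  rewrite (_ : [set _ | _] = `]s, +oo[%classic) //.
  by apply/seteqP; split => x /=; rewrite in_itv /= andbT.
rewrite RintegralD_indic // fine_lebesgue_measure_left //.
rewrite fine_lebesgue_measure_right //.
rewrite (_ : s - (a + dx) = s - a - dx); last by ring.
by field; exact: lt0r_neq0.
Qed.

(** * Shock speed and wave speeds of a convex flux *)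

Section ConvexFlux.
Context {R : realType} {f : R -> R}.
Hypothesis f_derivable : forall x : R, derivable f x 1.
Hypothesis f_convex : convex_function [set: R^o] f.

(** For [0 < h <= 1], convexity bounds the difference quotient of [f] at [x] in
    the direction [y - x] by [f y - f x]; let [h] tend to 0 from the right. *)
Lemma convex_ge_tangent (x y : R) : f x + f^`()%classic x * (y - x) <= f y.
Proof.
have df : differentiable f x by exact/derivable1_diffP.
have -> : f^`()%classic x * (y - x) = 'D_(y - x) f x.
  rewrite derive1E !deriveE// mulrC.
  by rewrite -[in RHS](mulr1 (y - x)) -[_ * 1]/(_ *: 1) linearZ.
have dfv : derivable f x (y - x) by exact: diff_derivable.
rewrite addrC -lerBrDr /derive cvg_at_rightE//.
apply: limr_le.
  by apply/cvg_ex; eexists; apply: cvg_dnbhs_at_right; exact: dfv.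
near=> h.
have h_gt0 : 0 < h by near: h; exact: nbhs_right_gt.
have h_le1 : h <= 1 by near: h; exact: nbhs_right_le.
have /= := f_convex (Itv01 (ltW h_gt0) h_le1) y x (in_setT _) (in_setT _).
rewrite !convRE /= /unstable.onem => fh.
rewrite -[_ *: _]/(_ * _) mulrC ler_pdivrMr//.
have -> : h *: (y - x) + x = h * y + (1 - h) * x.
  by rewrite -[_ *: _]/(_ * _); ring.
lra.
Unshelve. all: by end_near. Qed.

Lemma derive1_convex_le (x y : R) :
  x <= y -> f^`()%classic x <= f^`()%classic y.
Proof.
rewrite le_eqVlt => /predU1P[->//|xy].
have tx := convex_ge_tangent x y.
have ty := convex_ge_tangent y x.
have : (f^`()%classic x - f^`()%classic y) * (y - x) <= 0 by lra.
by rewrite pmulr_lle0 ?subr_gt0 // subr_le0.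
Qed.

Lemma shock_speed_between (ul ur : R) : ur < ul ->
  f^`()%classic ur <= shock_speed f ul ur <= f^`()%classic ul.
Proof.
move=> ur_lt_ul.
have tr := convex_ge_tangent ur ul.
have tl := convex_ge_tangent ul ur.
by rewrite /shock_speed ler_pdivlMr ?ler_pdivrMr ?subr_gt0 //; lra.
Qed.

(** A supremum bounds the values of a family only when the family is bounded:
    here monotonicity of [f'] on [[ur, ul]] provides the bound. *)
Lemma shock_speed_le_Vwaves (ul ur : R) (u : int -> R) (il ir : int) :
  ur < ul -> (forall j, ur <= u j <= ul) -> u il = ul -> u ir = ur ->
  `|shock_speed f ul ur| <= Vwaves f u.
Proof.
move=> ur_lt_ul u_in uil uir.
have bounded : has_ubound (range (fun j => `|f^`()%classic (u j)|)).
  exists (Num.max `|f^`()%classic ul| `|f^`()%classic ur|) => _ [j _ <-].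
  have /andP[/derive1_convex_le f'ge /derive1_convex_le f'le] := u_in j.
  rewrite le_max; apply/orP.
  have [?|?] := leP 0 (f^`()%classic (u j)).
    by left; rewrite !ger0_norm //; lra.
  by right; rewrite !ler0_norm //; lra.
have f'ul : `|f^`()%classic ul| <= Vwaves f u.
  by apply: ub_le_sup => //; exists il; rewrite ?uil.
have f'ur : `|f^`()%classic ur| <= Vwaves f u.
  by apply: ub_le_sup => //; exists ir; rewrite ?uir.
have /andP[? ?] := shock_speed_between _ _ ur_lt_ul.
by move: f'ul f'ur; rewrite !ler_norml; lra.
Qed.

End ConvexFlux.

(** * One step of the scheme on an averaged shock *)

(** Multiplying by the relative speed absorbs the convention that a vanishing
    relative speed gives an infinite crossing time. *)
Lemma crossing_timeM {R : realType} (delta dist rel : R) :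
  0 <= rel -> 0 <= dist ->
  crossing_time delta dist rel * rel = Num.min (rel * delta) dist.
Proof.
rewrite /crossing_time; case: eqP => [-> _ dist_ge0|/eqP rel0 rel_ge0 _].
  by rewrite mulr0 mul0r min_l.
by rewrite minr_pMl // divfK // mulrC.
Qed.

Section Step.
Context {R : realType}.
Variables (f : R -> R) (ul ur dx : R) (u : int -> R) (z : int -> R).
Hypothesis ur_lt_ul : ur < ul.
Hypothesis dx_gt0 : 0 < dx.
Hypothesis zS : forall j, z (j + 1) = z j - dx.
Hypothesis uE : forall j, u j = profile ul ur dx (z j).

Let sigma := shock_speed f ul ur.

Let zP j : z (j - 1) = z j + dx.
Proof. by rewrite -[in RHS](subrK 1 j) zS subrK. Qed.

Lemma shock_pos_cut j : 0 < z j < dx -> shock_pos dx u j = z j.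
Proof.
move=> /andP[z0 zd]; rewrite /shock_pos !uE zS zP.
rewrite (profile_right _ (z j - dx)) ?(profile_left _ (z j + dx)) //; try lra.
rewrite profile_mid; last lra.
by field; rewrite (lt0r_neq0 dx_gt0) subr_eq0 lt_eqF.
Qed.

(** Ahead of the shock [u j = u (j + 1) = ur], so the reconstructed position
    would be 0; behind it [u j = u (j - 1) = ul], so it would be [dx]. *)
Lemma reconstructed_iff_cut j : reconstructed dx u j = (0 < z j < dx).
Proof.
have [dx0 ul_gt] := (dx_gt0, ur_lt_ul).
have [z0|z0] := leP (z j) 0.
  rewrite /reconstructed /shock_pos !uE zS (profile_right _ (z j)) //.
  rewrite (profile_right _ (z j - dx)) //; last lra.
  by rewrite subrr mul0r mulr0 ltxx /= andbF.
have [zd|zd] := leP dx (z j).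
  rewrite /reconstructed /shock_pos !uE zP (profile_left _ (z j)) //.
  rewrite (profile_left _ (z j + dx)) //; last lra.
  apply/negbTE/negP => /and3P[u_lt _].
  by rewrite divff ?subr_eq0 ?(lt_eqF u_lt) // mulr1 ltxx.
rewrite /reconstructed shock_pos_cut ?z0 ?zd // !andbT !uE zS zP.
by rewrite (profile_right _ (z j - dx)) ?(profile_left _ (z j + dx)) //; lra.
Qed.

Lemma uLR_uncut j : ~~ (0 < z j < dx) -> uL dx u j = u j /\ uR dx u j = u j.
Proof. by rewrite /uL /uR reconstructed_iff_cut => /negbTE ->. Qed.

Lemma uLR_cut j : 0 < z j < dx ->
  [/\ uL dx u j = ul, uR dx u j = ur & speed f dx u j = sigma].
Proof.
move=> zj; have uLE : uL dx u j = ul.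
  by rewrite /uL reconstructed_iff_cut zj uE zP profile_left //; lra.
have uRE : uR dx u j = ur.
  by rewrite /uR reconstructed_iff_cut zj uE zS profile_right //; lra.
by rewrite /speed reconstructed_iff_cut zj uLE uRE.
Qed.

Variables (delta V : R).
Hypothesis delta_gt0 : 0 < delta.

(** The displacement of the shock relative to the mesh during the step. *)
Let w := (sigma - V) * delta.

(** The Rankine-Hugoniot relation in the frame of the mesh. *)
Lemma mesh_flux_jump :
  mesh_flux f V ul = mesh_flux f V ur + (ul - ur) * (sigma - V).
Proof.
rewrite /mesh_flux /sigma /shock_speed; field.
by rewrite lt0r_neq0 // subr_gt0.
Qed.

(** The exact mean flux through an interface at distance [y] to the left of
    the shock at the beginning of the step. *)
Definition shock_flux (y : R) : R :=
  mesh_flux f V ur + (ul - ur) / delta * (ramp (y + w) - ramp y).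

Lemma shock_flux_behind y :
  0 <= y -> 0 <= y + w -> shock_flux y = mesh_flux f V ul.
Proof.
move=> y0 yw0; rewrite /shock_flux !ramp_ge0// mesh_flux_jump /w.
by field; exact: lt0r_neq0.
Qed.

Lemma shock_flux_ahead y :
  y <= 0 -> y + w <= 0 -> shock_flux y = mesh_flux f V ur.
Proof. by move=> y0 yw0; rewrite /shock_flux !ramp_le0// subrr mulr0 addr0. Qed.

(** An interface that the shock does not cross sees a constant state. *)
Lemma shock_flux_uncut j y : ~~ (0 < z j < dx) ->
  (z j <= 0 -> y <= 0 /\ y + w <= 0) -> (dx <= z j -> 0 <= y /\ 0 <= y + w) ->
  shock_flux y = mesh_flux f V (u j).
Proof.
rewrite negb_and -!leNgt uE => /orP[z0 /(_ z0)[y0 yw0] _|zd _ /(_ zd)[y0 yw0]].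
  by rewrite profile_right // shock_flux_ahead.
by rewrite profile_left // shock_flux_behind.
Qed.

(** In the cut cell the shock reaches the right interface when it has covered
    the distance [dx - z j]. *)
Lemma right_fluxE j : 0 <= w <= dx ->
  right_flux f dx u delta V j = shock_flux (z (j + 1)).
Proof.
move=> /andP[w0 wd]; have dn : delta != 0 by exact: lt0r_neq0.
have rel0 : 0 <= sigma - V by rewrite -(pmulr_lge0 _ delta_gt0).
rewrite /right_flux zS; set tau := crossing_time _ _ _.
have [zj|zj] := boolP (0 < z j < dx); last first.
  have [-> ->] := uLR_uncut j zj.
  rewrite -mulrDl subrKC mulrAC divff // mul1r; symmetry.
  by apply: shock_flux_uncut zj _ _ => ?; lra.
have [uLE uRE spE] := uLR_cut j zj; rewrite uLE uRE.
have tauE : tau * (sigma - V) = Num.min w (dx - z j).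
  by rewrite /tau spE shock_pos_cut // crossing_timeM //; lra.
rewrite /shock_flux (ramp_le0 (z j - dx)); last lra.
have -> : ramp (z j - dx + w) = w - tau * (sigma - V).
  by rewrite tauE /ramp; case: ltP => ?; case: ltP => ?; lra.
by rewrite mesh_flux_jump /w; field.
Qed.

(** In the cut cell the shock reaches the left interface when it has covered
    the distance [z j]. *)
Lemma left_fluxE j : - dx <= w <= 0 ->
  left_flux f dx u delta V j = shock_flux (z j).
Proof.
move=> /andP[wd w0]; have dn : delta != 0 by exact: lt0r_neq0.
have rel0 : 0 <= V - sigma.
  by rewrite -(pmulr_lge0 _ delta_gt0) -opprB mulNr oppr_ge0.
rewrite /left_flux; set tau := crossing_time _ _ _.
have [zj|zj] := boolP (0 < z j < dx); last first.
  have [-> ->] := uLR_uncut j zj.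
  rewrite -mulrDl subrKC mulrAC divff // mul1r; symmetry.
  by apply: shock_flux_uncut zj _ _ => ?; have dx0 := dx_gt0; lra.
have [uLE uRE spE] := uLR_cut j zj; rewrite uLE uRE.
have tauE : tau * (V - sigma) = Num.min (- w) (z j).
  rewrite /tau spE shock_pos_cut // crossing_timeM //; last lra.
  by congr Num.min; rewrite /w; ring.
rewrite /shock_flux (ramp_ge0 (z j)); last lra.
have -> : ramp (z j + w) = z j - tau * (V - sigma).
  by rewrite tauE /ramp; case: ltP => ?; case: ltP => ?; lra.
by rewrite mesh_flux_jump; field.
Qed.

(** [dx * u j] involves [ramp (z j) - ramp (z (j + 1))]; the two interface
    fluxes replace each [ramp y] by [ramp (y + w)]. *)
Lemma update_profile j :
  (if V < 0 then 0 <= w <= dx else - dx <= w <= 0) ->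
  update f dx u delta V j = profile ul ur dx (z j + w).
Proof.
have dn : delta != 0 by exact: lt0r_neq0.
have dxn : dx != 0 by exact: lt0r_neq0.
move=> wV; have fluxE k : flux f dx u delta V k = shock_flux (z (k + 1)).
  rewrite /flux; case: ifP wV => _ ?; first exact: right_fluxE.
  exact: left_fluxE.
rewrite /update !fluxE subrK uE /profile /shock_flux !zS.
rewrite (_ : z j + w - dx = z j - dx + w); last by ring.
by field; rewrite dn dxn.
Qed.

End Step.

(** * Exactness at all times *)

Lemma interface_affine {R : realType} (dx : R) (dt Vmesh : nat -> R) n j :
  interface dx dt Vmesh n j = interface dx dt Vmesh n 0 + j%:~R * dx.
Proof. by elim: n => [|n IHn] /=; [rewrite mul0r; ring | rewrite IHn; ring]. Qed.

Lemma interfaceS {R : realType} (dx : R) (dt Vmesh : nat -> R) n j :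
  interface dx dt Vmesh n (j + 1) = interface dx dt Vmesh n j + dx.
Proof.
by rewrite interface_affine [in RHS]interface_affine intrD mulrDl mul1r addrA.
Qed.

Theorem proposition1p4 (R : realType) (f : R -> R) (ul ur dx : R)
    (dt Vmesh : nat -> R)
    (f_derivable : forall x : R, derivable f x 1)
    (f'_continuous : continuous (f^`()%classic))
    (f_convex : convex_function [set: R^o] f)
    (ur_lt_ul : ur < ul)
    (dx_gt0 : 0 < dx)
    (dt_gt0 : forall n : nat, 0 < dt n)
    (u := scheme f dx dt Vmesh (shock_datum ul ur))
    (Vmesh_neq0 : forall n : nat, Vmesh n != 0)
    (Vwaves_le_Vmesh : forall n : nat, Vwaves f (u n) <= `|Vmesh n|)
    (cfl : forall n : nat, dt n <= dx / (`|Vmesh n| + Vwaves f (u n))) :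
  forall (n : nat) (j : int),
    u n j = cell_average dx
              (interface dx dt Vmesh n (j - 1)) (interface dx dt Vmesh n j)
              (shock_solution f ul ur (time dt n)).
Proof.
pose sigma := shock_speed f ul ur.
pose z n j := sigma * time dt n - interface dx dt Vmesh n (j - 1).
have zS n j : z n (j + 1) = z n j - dx.
  by rewrite /z -[in LHS]addrAC interfaceS; ring.
have averageE n j : cell_average dx (interface dx dt Vmesh n (j - 1))
    (interface dx dt Vmesh n j) (shock_solution f ul ur (time dt n)) =
    profile ul ur dx (z n j).
  by apply: cell_average_shock => //; rewrite -interfaceS subrK.
suff uE n j : u n j = profile ul ur dx (z n j) by move=> n j; rewrite averageE.
elim: n j => [|n IHn] j.
  rewrite -averageE /u /scheme; congr cell_average.
  by apply/funext => x; rewrite /shock_datum /shock_solution /= mulr0.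
(* Cells entirely behind and entirely ahead of the shock; since [z n] is affine
   in the index with slope [- dx], rounding [z n 0 / dx] locates them. *)
have [il uil] : exists il, u n il = ul.
  exists (Num.floor ((z n 0 - dx) / dx)); rewrite IHn profile_left //.
  have := floor_le ((z n 0 - dx) / dx); rewrite ler_pdivlMr //.
  rewrite /z interface_affine [in X in _ -> X]interface_affine !intrD.
  lra.
have [ir uir] : exists ir, u n ir = ur.
  exists (Num.floor (z n 0 / dx) + 1); rewrite IHn profile_right //.
  have := floorD1_gt (z n 0 / dx); rewrite ltr_pdivrMr //.
  rewrite /z interface_affine [in X in _ -> X]interface_affine !intrD.
  lra.
have sigma_le : `|sigma| <= Vwaves f (u n).
  apply: (shock_speed_le_Vwaves f_derivable f_convex _ _ _ il ir) => // k.
  by rewrite IHn; exact: profile_between.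
have dt0 := dt_gt0 n.
have sigmaV := le_trans sigma_le (Vwaves_le_Vmesh n).
have := cfl n; rewrite ler_pdivlMr; last first.
  by rewrite ltr_wpDr ?normr_gt0 // (le_trans _ sigma_le).
move=> dtW; have w_le : `|sigma - Vmesh n| * dt n <= dx.
  apply: le_trans dtW; rewrite mulrC ler_pM2l // [leRHS]addrC.
  by apply: (le_trans (ler_normB _ _)); rewrite lerD2r.
have -> : z n.+1 j = z n j + (sigma - Vmesh n) * dt n by rewrite /z /=; ring.
apply: update_profile => //; rewrite -/sigma.
case: ltP => V0.
  have rel0 : 0 <= sigma - Vmesh n.
    by move: sigmaV; rewrite (ltr0_norm V0) ler_norml; lra.
  by rewrite mulr_ge0 ?(ltW dt0) //= -(ger0_norm rel0).
have rel0 : sigma - Vmesh n <= 0.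
  by move: sigmaV; rewrite (ger0_norm V0) ler_norml; lra.
move: w_le; rewrite (ler0_norm rel0) mulNr lerNl => -> /=.
by rewrite mulr_le0_ge0 // ltW.
Qed.
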